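(* Let $q$ be a power of two, $A$ a $q$-modular witness in a graph $G$, $U\subseteq A$, and $n_B=|\{x\in A\setminus U:N(x)\cap U=B\}|$ for $B\subseteq U$. Choose a lift $d$ modulo $2q$ of the common residue modulo $q$ of the degrees $\deg_A(v)$, and define $b_A(v)\in\{0,1\}$ by $\deg_A(v)\equiv d+qb_A(v)\pmod{2q}$. Then there is NO family of pairwise disjoint $q$-element subsets of $A\setminus U$, each consisting of vertices with a common trace on $U$, whose deletion (leaving $W$) makes all $\deg_W(u)$, $u\in U$, congruent modulo $2q$, if and only if there exists a nonempty $Y\subseteq U$ with $|Y|\equiv0\pmod2$, $\sum_{u\in Y}b_A(u)\equiv1\pmod2$, and $|B\cap Y|\equiv0\pmod2$ for every $B\subseteq U$ with $n_B\ge q$. Equivalently, for the fixed core $U$ exactly one of the following holds: (1) such a deletion family exists; (2) such an even set $Y$ exists.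
   Context: Graphs are finite simple; $\deg_S(v)$ is the degree of $v$ in $G[S]$; $S$ is $q$-modular if all $\deg_S(v)$, $v\in S$, are congruent modulo $q$. The trace of $x$ on $U$ is $N(x)\cap U$. *)

(* Defs.v *)
From mathcomp Require Import all_boot.

Set Implicit Arguments.
Unset Strict Implicit.
Unset Printing Implicit Defensive.

Section Degrees.
Variables (T : finType) (e : rel T).

(* The degree of v in the induced subgraph on S; only meant for v in S. *)
Definition deg (S : {set T}) (v : T) : nat := #|[set w in S | e v w]|.

Definition modular (q : nat) (S : {set T}) : Prop :=
  {in S &, forall u v, deg S u = deg S v %[mod q]}.

Definition trace (U : {set T}) (x : T) : {set T} := [set w in U | e x w].

Definition trace_count (A U B : {set T}) : nat :=
  #|[set x in A :\: U | trace U x == B]|.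

(* The empty family is allowed.  As the blocks have q > 0 elements, a set of
   pairwise disjoint blocks carries the same data as an indexed family. *)
Definition deletion_family (q : nat) (A U : {set T}) (F : {set {set T}}) : Prop :=
  [/\ trivIset F,
      forall X, X \in F ->
        [/\ X \subset A :\: U, #|X| = q &
            {in X &, forall x y, trace U x = trace U y}] &
      {in U &, forall u v,
        deg (A :\: cover F) u = deg (A :\: cover F) v %[mod 2 * q]}].

Definition has_deletion_family (q : nat) (A U : {set T}) : Prop :=
  exists F : {set {set T}}, deletion_family q A U F.

Definition even_obstruction (q : nat) (A U : {set T}) (b : T -> bool)
    (Y : {set T}) : Prop :=
  [/\ Y != set0, Y \subset U, #|Y| = 0 %[mod 2],
      \sum_(u in Y) b u = 1 %[mod 2] &
      forall B : {set T}, B \subset U -> q <= trace_count A U B ->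
        #|B :&: Y| = 0 %[mod 2]].

Definition has_even_obstruction (q : nat) (A U : {set T}) (b : T -> bool) : Prop :=
  exists Y : {set T}, even_obstruction q A U b Y.

End Degrees.

(* Main.v *)
Require Import Defs.
From mathcomp Require Import all_boot.

Set Implicit Arguments.
Unset Strict Implicit.
Unset Printing Implicit Defensive.

(** Deleting a [q]-block with trace [B] changes the degrees modulo [2 * q] of
    exactly the vertices of [B], by [q].  Hence a deletion family exists iff
    adding to [b], over the field with two elements, the indicators of some
    traces of multiplicity at least [q] gives a constant function on [U].
    By linear duality this fails iff some vector [Y] is orthogonal to the
    constants and to all these indicators, but not to [b]. *)

(** * Linear duality over the field with two elements *)

Section Alternative.
Variables (T : finType) (U : {set T}).

(** The standard bilinear form on functions from [U] to the field with two elements; values outside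
    [U] are ignored. *)
Definition pairing (y f : T -> bool) : bool :=
  \big[addb/false]_(u in U) (y u && f u).

Lemma pairing_addl (y z f : T -> bool) :
  pairing (fun u => y u (+) z u) f = pairing y f (+) pairing z f.
Proof. by rewrite -big_split; apply: eq_bigr => u _; rewrite /= andb_addl. Qed.

Lemma pairing_addr (y f g : T -> bool) :
  pairing y (fun u => f u (+) g u) = pairing y f (+) pairing y g.
Proof. by rewrite -big_split; apply: eq_bigr => u _; rewrite /= andb_addr. Qed.

Lemma pairingE (y f : T -> bool) :
  pairing y f = odd (\sum_(u in [set u in U | y u]) f u).
Proof.
rewrite (big_morph odd oddD (erefl _)) /pairing.
under [RHS]eq_bigl => u do rewrite inE.
rewrite big_mkcondr; apply: eq_bigr => u _.
by case: (y u) => //=; rewrite oddb.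
Qed.

Lemma pairing_pred1 (w : T) (f : T -> bool) :
  w \in U -> pairing (pred1 w) f = f w.
Proof.
move=> wU; rewrite /pairing (bigD1 w) //= eqxx /= big1 ?addbF // => u.
by case/andP=> _ /negPf ->.
Qed.

(** Induction on [s] for all [b] at once: the head [B] is either left out, keeping [b], or used,
    replacing [b] by its sum with the indicator of [B]. If both choices fail, their two certificates
    combine into one for [B :: s]. A subsequence suffices because a set used twice cancels. *)
Lemma constant_alternative (b : T -> bool) (s : seq {set T}) :
  (exists2 t, subseq t s &
     {in U &, forall u v, b u (+) \big[addb/false]_(B <- t) (u \in B)
                        = b v (+) \big[addb/false]_(B <- t) (v \in B)}) \/
  (exists y : T -> bool,
     [/\ pairing y xpredT = false, pairing y b = true &
         forall B : {set T}, B \in s -> pairing y (fun u => u \in B) = false]).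
Proof.
elim: s b => [|B s IHs] b.
  case: (boolP [forall u in U, forall v in U, b u == b v]) => [cb|].
    left; exists [::] => // u v uU vU; rewrite !big_nil !addbF.
    by move/forall_inP/(_ u uU)/forall_inP/(_ v vU)/eqP: cb.
  case/forall_inPn=> u uU /forall_inPn[v vU nbuv]; right.
  (* Two points where [b] differs: their indicators sum to a vector that kills constants but not
     [b]. *)
  exists (fun w => pred1 u w (+) pred1 v w).
  rewrite !pairing_addl !pairing_pred1 //; split=> //.
  by move: nbuv; case: (b u); case: (b v).
case: (IHs b) => [[t ts ct]|[y [y1 yb ys]]].
  by left; exists t => //; apply: subseq_trans ts (subseq_cons _ _).
have in_s z C : (forall D : {set T}, D \in s -> pairing z (fun u => u \in D) = false) ->
    pairing z (fun u => u \in B) = false ->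
    C \in B :: s -> pairing z (fun u => u \in C) = false.
  by move=> zs zB; rewrite inE => /predU1P[-> //|]; apply: zs.
case: (IHs (fun u => b u (+) (u \in B))) => [[t ts ct]|[z [z1 zb zs]]].
  left; exists (B :: t); first by rewrite /= eqxx.
  by move=> u v uU vU; rewrite !big_cons !addbA; apply: ct.
right; have [yB|yB] := boolP (pairing y (fun u => u \in B)); last first.
  by exists y; split=> // C; apply: in_s => //; apply: negPf.
move: zb; rewrite pairing_addr => zb.
have [zB|zB] := boolP (pairing z (fun u => u \in B)); last first.
  exists z; split=> //.
  - by move: zb; rewrite (negPf zB) addbF.
  - by move=> C; apply: in_s => //; apply: negPf.
(* Neither [y] nor [z] is orthogonal to [B], so their sum is; moreover [z] now pairs to 0 with [b],
   so the sum still pairs to 1 with [b]. *)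
exists (fun u => y u (+) z u); split.
- by rewrite pairing_addl y1 z1.
- by move: zb; rewrite pairing_addl yb zB; case: (pairing z b).
move=> C; apply: in_s => [D Ds|]; rewrite pairing_addl; first by rewrite ys ?zs.
by rewrite yB zB.
Qed.

End Alternative.

(** * Effect of deleting blocks on degrees *)

Section Deletion.
Variables (T : finType) (e : rel T) (q : nat) (A U : {set T}).
Hypotheses (e_sym : symmetric e) (q_gt0 : 0 < q) (sUA : U \subset A).

Definition block (X : {set T}) : Prop :=
  [/\ X \subset A :\: U, #|X| = q &
      {in X &, forall x y, trace e U x = trace e U y}].

(** The union names the common trace of a block without choosing one of its vertices. *)
Definition block_trace (X : {set T}) : {set T} := \bigcup_(x in X) trace e U x.

Lemma block_traceE (X : {set T}) (x : T) :
  block X -> x \in X -> block_trace X = trace e U x.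
Proof.
case=> _ _ trX xX; apply/setP=> u; apply/bigcupP/idP=> [[y yX]|ux].
  by rewrite (trX _ _ yX xX).
by exists x.
Qed.

Lemma block_has_mem (X : {set T}) : block X -> exists x, x \in X.
Proof. by case=> _ cX _; apply/card_gt0P; rewrite cX. Qed.

Lemma block_trace_count (X : {set T}) :
  block X -> q <= trace_count e A U (block_trace X).
Proof.
move=> bX; case: (bX) => sX <- _; apply: subset_leq_card; apply/subsetP=> x xX.
by rewrite inE (block_traceE bX xX) eqxx andbT (subsetP sX).
Qed.

Lemma block_trace_sub (X : {set T}) : block_trace X \subset U.
Proof. by apply/bigcupsP=> x _; apply/subsetP=> u; rewrite inE => /andP[]. Qed.

(** By symmetry of [e], a vertex of [U] is adjacent to all of a block or to none of it. *)
Lemma card_nbhs_block (X : {set T}) (u : T) : block X -> u \in U ->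
  #|[set w in X | e u w]| = q * (u \in block_trace X).
Proof.
move=> bX uU; have [_ cX _] := bX.
have -> : [set w in X | e u w] = if u \in block_trace X then X else set0.
  apply/setP=> w; rewrite inE; case: (boolP (w \in X)) => [wX|wX].
    rewrite (block_traceE bX wX) !inE uU /= e_sym.
    by case: ifP; rewrite ?wX ?inE.
  by case: ifP; rewrite ?(negPf wX) ?inE.
by case: ifP; rewrite ?cards0 ?muln0 ?muln1.
Qed.

Variable F : {set {set T}}.
Hypotheses (trivF : trivIset F) (blockF : forall X, X \in F -> block X).

Definition hits (u : T) : nat := \sum_(X in F) (u \in block_trace X).

(** The neighbours of [u] lost are those in the cover; the blocks are disjoint and lie in [A], and
    each contributes [q] or 0. *)
Lemma deg_deletion (u : T) : u \in U ->
  deg e A u = deg e (A :\: cover F) u + q * hits u.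
Proof.
move=> uU; rewrite /deg -(cardsID (cover F)) addnC; congr (_ + _).
  by apply: eq_card => w; rewrite !inE andbA.
rewrite -sum1_card /hits [RHS]big_distrr /=.
rewrite (eq_bigl [pred w in cover F | e u w]); last first.
  move=> w; rewrite !inE; case wF: (w \in cover F); rewrite ?andbF //= andbT.
  case/bigcupP: wF => X XF wX; have [/subsetP/(_ w wX) + _ _] := blockF XF.
  by rewrite inE => /andP[_ ->].
rewrite big_trivIset_cond //=; apply: eq_bigr => X XF.
rewrite -(card_nbhs_block (blockF XF) uU) -sum1_card.
by apply: eq_bigl => w; rewrite inE.
Qed.

Variables (d : nat) (b : T -> bool).
Hypothesis b_def : {in A, forall v, deg e A v = d + q * b v %[mod 2 * q]}.

Lemma deg_deletion_mod (u v : T) : u \in U -> v \in U ->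
  (deg e (A :\: cover F) u == deg e (A :\: cover F) v %[mod 2 * q])
    = (b u (+) odd (hits u) == b v (+) odd (hits v)).
Proof.
have degE w : w \in U ->
    deg e (A :\: cover F) w = d + q * (b w + hits w) %[mod 2 * q].
  move=> wU; rewrite mulnDr addnA -modnDml -(b_def (subsetP sUA _ wU)) modnDml.
  (* Modulo [2 * q], removing [q * hits w] amounts to adding it, which avoids subtraction. *)
  by rewrite (deg_deletion wU) -addnA addnn -mul2n mulnA [2 * q * _]mulnC
             [in RHS]addnC modnMDl.
move=> uU vU; rewrite !degE // eqn_modDl [2 * q]mulnC -!muln_modr.
by rewrite eqn_pmul2l // !modn2 !oddD !oddb; do 2!case: (_ (+) _).
Qed.

End Deletion.

(** * Blocks with prescribed traces *)

Section Construction.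
Variables (T : finType) (e : rel T) (q : nat) (A U : {set T}).
Hypothesis q_gt0 : 0 < q.

Definition class_block (B : {set T}) : {set T} :=
  [set x in take q (enum [set x in A :\: U | trace e U x == B])].

Lemma mem_class_block (B : {set T}) (x : T) :
  x \in class_block B -> x \in A :\: U /\ trace e U x = B.
Proof.
by rewrite inE => /mem_take; rewrite mem_enum inE => /andP[? /eqP].
Qed.

Lemma class_blockP (B : {set T}) :
  q <= trace_count e A U B -> block e q A U (class_block B).
Proof.
move=> qB; split.
- by apply/subsetP=> x /mem_class_block[].
- rewrite cardsE (card_uniqP _) ?take_uniq ?enum_uniq //.
  by rewrite size_takel // -cardE.
by move=> x y /mem_class_block[_ ->] /mem_class_block[_ ->].
Qed.

Lemma block_trace_class_block (B : {set T}) :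
  q <= trace_count e A U B -> block_trace e U (class_block B) = B.
Proof.
move=> /class_blockP bB; have [x xB] := block_has_mem q_gt0 bB.
by rewrite (block_traceE bB xB); case: (mem_class_block xB).
Qed.

Lemma trivIset_class_block (S : {set {set T}}) :
  trivIset [set class_block B | B in S].
Proof.
apply/trivIsetP=> _ _ /imsetP[B _ ->] /imsetP[C _ ->] neqBC.
rewrite -setI_eq0; apply: contra_neqT neqBC => /set0Pn[x].
by rewrite inE => /andP[/mem_class_block[_ <-] /mem_class_block[_ <-]].
Qed.

Lemma hits_class_block (S : {set {set T}}) (u : T) :
  (forall B, B \in S -> q <= trace_count e A U B) ->
  hits e U [set class_block B | B in S] u = \sum_(B in S) (u \in B).
Proof.
move=> qS; rewrite /hits big_imset /=; last first.
  (* Reindexing needs injectivity: a block cut from a class of size at least [q] is nonempty and so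
     recovers its trace. *)
  move=> B C /qS qB /qS qC eqBC.
  by rewrite -(block_trace_class_block qB) eqBC block_trace_class_block.
by apply: eq_bigr => B /qS qB; rewrite block_trace_class_block.
Qed.

End Construction.

Lemma eq0_mod2 (n : nat) : (n = 0 %[mod 2]) <-> (odd n = false).
Proof. by rewrite !modn2; case: (odd n). Qed.

Lemma eq1_mod2 (n : nat) : (n = 1 %[mod 2]) <-> (odd n = true).
Proof. by rewrite !modn2; case: (odd n). Qed.

(** * Exclusivity and exhaustiveness of the alternatives *)

Section Dichotomy.
Variables (T : finType) (e : rel T) (q : nat) (A U : {set T}).
Variables (d : nat) (b : T -> bool).
Hypotheses (e_sym : symmetric e) (q_gt0 : 0 < q) (sUA : U \subset A).
Hypothesis b_def : {in A, forall v, deg e A v = d + q * b v %[mod 2 * q]}.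

Lemma obstruction_no_deletion :
  has_even_obstruction e q A U b -> ~ has_deletion_family e q A U.
Proof.
case=> Y [/set0Pn[v vY] /subsetP sYU /eq0_mod2 evenY /eq1_mod2 oddb_ orthY].
case=> F [trivF blockF degF].
(* The parity of this sum is computed twice. Summed block by block, the hits give the even numbers
   [#|block_trace e U X :&: Y|], so the total is odd like the sum of [b]. Yet all terms have the
   parity of the one at [v], and [#|Y|] is even. *)
suff: odd (\sum_(u in Y) (b u + hits e U F u)) = false.
  rewrite big_split oddD oddb_ /hits exchange_big /=.
  rewrite [X in odd X](_ : _ = \sum_(X in F) #|block_trace e U X :&: Y|).
    rewrite (big_morph odd oddD (erefl _)) big1 // => X XF.
    apply/eq0_mod2/orthY; first exact: block_trace_sub.
    exact: block_trace_count (blockF _ XF).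
  apply: eq_bigr => X _; rewrite -sum1_card big_mkcond [RHS]big_mkcond /=.
  by apply: eq_bigr => u _; rewrite inE; case: (_ \in Y); rewrite ?andbF ?andbT //;
     case: (_ \in _).
rewrite (big_morph odd oddD (erefl _)).
rewrite (eq_bigr (fun=> odd (b v + hits e U F v))) => [|u uY].
  have iter_addb c n : iter n (addb c) (odd 0) = odd n && c.
    by elim: n => //= n ->; case: c; case: (odd n).
  by rewrite big_const iter_addb evenY.
rewrite !oddD !oddb; apply/eqP.
rewrite -(deg_deletion_mod e_sym q_gt0 sUA trivF blockF b_def) ?sYU //.
by apply/eqP/degF; apply: sYU.
Qed.

Lemma deletion_or_obstruction :
  has_deletion_family e q A U \/ has_even_obstruction e q A U b.
Proof.
(* Enumerated without repetition, so a subsequence of [s] is a set of traces and one block per trace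
   is enough. *)
pose s := enum [set B : {set T} | (B \subset U) && (q <= trace_count e A U B)].
case: (constant_alternative U b s) => [[t ts ct]|[y [y1 yb ys]]]; [left|right].
  have qt B : B \in [set B in t] -> q <= trace_count e A U B.
    by rewrite inE => /(mem_subseq ts); rewrite mem_enum inE => /andP[].
  pose F := [set class_block e q A U B | B in [set B in t]].
  have trivF : trivIset F by apply: trivIset_class_block.
  have blockF X : X \in F -> block e q A U X.
    by case/imsetP=> B /qt qB ->; apply: class_blockP.
  have hitsE u : odd (hits e U F u) = \big[addb/false]_(B <- t) (u \in B).
    rewrite hits_class_block // (big_morph odd oddD (erefl _)).
    rewrite big_uniq ?(subseq_uniq ts) ?enum_uniq //=.
    by apply: eq_big => [B|B _]; rewrite ?inE ?oddb.
  exists F; split=> // u v uU vU; apply/eqP.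
  by rewrite (deg_deletion_mod e_sym q_gt0 sUA trivF blockF b_def) // !hitsE (ct u v).
exists [set u in U | y u]; split.
(* An empty set would pair to 0 with [b]. *)
- apply: contra_eq_neq yb => Y0.
  by rewrite pairingE Y0 big_set0.
- by apply/subsetP=> u; rewrite inE => /andP[].
- by apply/eq0_mod2; rewrite -y1 pairingE sum1_card.
- by apply/eq1_mod2; rewrite -pairingE.
move=> B sBU qB; apply/eq0_mod2; rewrite -(ys B); last by rewrite mem_enum inE sBU.
rewrite pairingE -sum1_card big_mkcond [in RHS]big_mkcond /=; congr odd.
by apply: eq_bigr => u _; rewrite !inE; case: (u \in B); case: (u \in U); case: (y u).
Qed.

End Dichotomy.

Theorem mainTheorem10 (T : finType) (e : rel T)
  (e_sym : symmetric e) (e_irr : irreflexive e)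
  (q : nat) (q_pow2 : exists k : nat, q = 2 ^ k)
  (A U : {set T}) (A_mod : modular e q A) (sUA : U \subset A)
  (d : nat) (d_lift : {in A, forall v, deg e A v = d %[mod q]})
  (b : T -> bool)
  (b_def : {in A, forall v, deg e A v = d + q * b v %[mod 2 * q]}) :
  (~ has_deletion_family e q A U <-> has_even_obstruction e q A U b) /\
  ((has_deletion_family e q A U /\ ~ has_even_obstruction e q A U b) \/
   (~ has_deletion_family e q A U /\ has_even_obstruction e q A U b)).
Proof.
have q_gt0 : 0 < q by case: q_pow2 => k ->; rewrite expn_gt0.
have excl := obstruction_no_deletion e_sym q_gt0 sUA b_def.
have := deletion_or_obstruction e_sym q_gt0 sUA b_def.
tauto.
Qed.
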